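(* Let $A$ be an integer $\sigma$-set and let $M,N\in 3^{A}$ be such that the equation $X\oplus M=N$ in the unknown $\sigma$-set $X$ of $3^{A}$ is fusionable, i.e. $M\widehat{\cap}N=\emptyset$. Put $R:=M\oplus N^{-}$. Then $$S_{1}=N\oplus R^{-}\qquad\text{and}\qquad S_{2}=R^{-}$$ are solutions of the equation $X\oplus M=N$; that is, $S_{1}\oplus M=N$ and $S_{2}\oplus M=N$.
   Context: Background on $\sigma$-sets: in $\sigma$-set theory (a theory of classes) two elements $x,y$ are called antielements of each other when $\{x\}\cup\{y\}=\emptyset$, where $\cup$ here is the primitive pair union of the theory. If $x$ has an antielement it is denoted $x^{\ast}$; the relation is symmetric, so $(x^{\ast})^{\ast}=x$. If $x$ has no antielement, then the condition ''$x^{\ast}\in B$'' is false. A basic known fact of the theory is that a $\sigma$-set never contains both an element $x$ and its antielement $x^{\ast}$. $\sigma$-sets are determined by their elements, and $\emptyset$ is the $\sigma$-set with no elements. Definitions, for $\sigma$-sets $A,B$: - $2^{A}$ is the collection of all subsets of $A$. - $\ast$-intersection: $A\widehat{\cap}B=\{x\in A : x^{\ast}\in B\}$. - Difference: $A-B=\{x\in A: x\notin B\}$. - $\ast$-difference: $A\divideontimes B=A-(A\widehat{\cap}B)$. - Fusion: $A\oplus B=\{x : x\in A\divideontimes B\ \vee\ x\in B\divideontimes A\}$. (Fusion is commutative but not associative in general.) - $B$ is the $\sigma$-antiset of $A$, written $B=A^{-}$, if $A\oplus B=\emptyset$ (equivalently, every element of $A$ has an antielement and $A^{-}=\{x^{\ast}:x\in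 A\}$). - $A$ is an integer (or entire) $\sigma$-set if its $\sigma$-antiset $A^{-}$ exists. - Generated space: $\left\langle 2^{A},2^{B}\right\rangle=\{x\oplus y : x\in 2^{A}\wedge y\in 2^{B}\}$. - Integer space of an integer $\sigma$-set $A$: $3^{A}=\left\langle 2^{A},2^{A^{-}}\right\rangle$. - A $\sigma$-set equation $X\oplus M=N$ is called fusionable if $M\widehat{\cap}N=\emptyset$. *)

(* Defs.v *)
From Stdlib Require Import ClassicalEpsilon.

(* The language of sigma-set theory: [carrier] is the universe of sigma-sets,
   whose elements are themselves sigma-sets, and [pair_union] is the primitive
   union of the theory, which is not determined by the usual union of
   elements. *)
Record sigma_structure := SigmaStructure {
  carrier :> Type;
  mem : carrier -> carrier -> Prop;
  empty : carrier;
  singleton : carrier -> carrier;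
  pair_union : carrier -> carrier -> carrier
}.

Arguments mem {_} _ _.
Arguments empty {_}.
Arguments singleton {_} _.
Arguments pair_union {_} _ _.

Section SigmaSets.

Context {V : sigma_structure}.
Implicit Types A B M N X x y z : V.

(* Classes of sigma-sets, proper or not, are predicates on the universe. *)
Definition class := V -> Prop.

Definition has_elements A (C : class) : Prop := forall x, mem x A <-> C x.

Definition is_sigma_set (C : class) : Prop := exists A, has_elements A C.

(* The sigma-set {x : C x}.  It is meaningful only when [is_sigma_set C]. *)
Definition set_of (C : class) : V :=
  epsilon (inhabits empty) (fun A => has_elements A C).

Definition antielement x y : Prop :=
  pair_union (singleton x) (singleton y) = empty.

(* "x* belongs to B"; false when x has no antielement. *)
Definition star_mem x B : Prop := exists y, antielement x y /\ mem y B.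

Definition star_cap_class A B : class := fun x => mem x A /\ star_mem x B.
Definition star_cap A B : V := set_of (star_cap_class A B).

Definition diff_class A B : class := fun x => mem x A /\ ~ mem x B.
Definition diff A B : V := set_of (diff_class A B).

Definition star_diff A B : V := diff A (star_cap A B).

Definition fusion_class A B : class :=
  fun x => mem x (star_diff A B) \/ mem x (star_diff B A).
Definition fusion A B : V := set_of (fusion_class A B).

Definition is_antiset A B : Prop := fusion A B = empty.

Definition integer_set A : Prop := exists B, is_antiset A B.

(* A^-; meaningful only when [integer_set A]. *)
Definition antiset A : V := epsilon (inhabits empty) (is_antiset A).

Definition subset A B : Prop := forall x, mem x A -> mem x B.

Definition power A : class := fun X => subset X A.

Definition generated_space (P Q : class) : class :=
  fun z => exists x y, P x /\ Q y /\ z = fusion x y.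

Definition integer_space A : class :=
  generated_space (power A) (power (antiset A)).

Definition fusionable M N : Prop := star_cap M N = empty.

(* X solves X (+) M = N, the unknown ranging over 3^A. *)
Definition is_solution A M N X : Prop :=
  integer_space A X /\ fusion X M = N.

End SigmaSets.

(* The facts of sigma-set theory on which the calculus of fusion rests.
   The last three say that the classes named are sigma-sets, so that the
   operations [star_cap], [diff] and [fusion] have their intended elements. *)
Record sigma_theory (V : sigma_structure) : Prop := SigmaTheory {
  extensionality : forall A B : V, (forall x, mem x A <-> mem x B) -> A = B;
  mem_empty : forall x : V, ~ mem x empty;
  mem_singleton : forall x y : V, mem y (singleton x) <-> y = x;
  antielement_sym : forall x y : V, antielement x y -> antielement y x;
  antielement_unique :
    forall x y z : V, antielement x y -> antielement x z -> y = z;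
  antielement_exclusion :
    forall A x y : V, antielement x y -> mem x A -> ~ mem y A;
  star_cap_set : forall A B : V, is_sigma_set (star_cap_class A B);
  diff_set : forall A B : V, is_sigma_set (diff_class A B);
  fusion_set : forall A B : V, is_sigma_set (fusion_class A B)
}.

(* Main.v *)
From Stdlib Require Import Classical ClassicalEpsilon.
Require Import Defs.

(** Membership of the space [3^A] means that every element lies in [A] or is the
    antielement of an element of [A]; this class is closed under fusion and
    antisets.  Writing * for the passage to antielements, R is
    (M \ N) u (N \ M)*, hence R^- is (M \ N)* u (N \ M).  Fusing R^- with M
    cancels M \ N against its antielements and leaves (N \ M) u (M n N) = N;
    fusionability ensures that nothing else cancels.  Fusing R^- with N first
    only adds the elements of M n N, which M contributes anyway. *)

Section SigmaTheory.

Context {V : sigma_structure} (HV : sigma_theory V).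
Implicit Types A B M N X x y : V.

Lemma mem_set_of (C : class) x : is_sigma_set C -> mem x (set_of C) <-> C x.
Proof.
intros HC.
exact (epsilon_spec (inhabits empty) (fun A : V => has_elements A C) HC x).
Qed.

Lemma mem_star_cap A B x : mem x (star_cap A B) <-> mem x A /\ star_mem x B.
Proof. exact (mem_set_of _ x (star_cap_set _ HV A B)). Qed.

Lemma mem_diff A B x : mem x (diff A B) <-> mem x A /\ ~ mem x B.
Proof. exact (mem_set_of _ x (diff_set _ HV A B)). Qed.

Lemma mem_fusion A B x :
  mem x (fusion A B) <->
  (mem x A /\ ~ star_mem x B) \/ (mem x B /\ ~ star_mem x A).
Proof.
unfold fusion; rewrite (mem_set_of _ x (fusion_set _ HV A B)).
unfold fusion_class, star_diff; rewrite !mem_diff, !mem_star_cap; tauto.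
Qed.

Lemma eq_empty A : A = empty <-> forall x, ~ mem x A.
Proof.
split.
- intros -> x; exact (mem_empty _ HV x).
- intros H; apply (extensionality _ HV); intros x; split.
  + intros Hx; destruct (H x Hx).
  + intros Hx; destruct (mem_empty _ HV x Hx).
Qed.

Lemma star_mem_exclusion A x : mem x A -> ~ star_mem x A.
Proof.
intros Hx [y [Hxy Hy]]; exact (antielement_exclusion _ HV A x y Hxy Hx Hy).
Qed.

(** Uniqueness of antielements turns the existential in [star_mem] into plain membership of the one
    candidate [y]. *)
Lemma star_mem_antielement A x y : antielement x y -> star_mem x A <-> mem y A.
Proof.
intros Hxy; split.
- intros [z [Hxz Hz]]; rewrite (antielement_unique _ HV x y z Hxy Hxz); exact Hz.
- intros Hy; exists y; auto.
Qed.

(** The fusion is empty exactly when every element of either side is cancelled by the other.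
    Emptiness only refutes non-cancellation, hence the classical step. *)
Lemma is_antisetE A B :
  is_antiset A B <->
  (forall x, mem x A -> star_mem x B) /\ (forall x, mem x B -> star_mem x A).
Proof.
unfold is_antiset; rewrite eq_empty; split.
- intros H; split; intros x Hx; apply NNPP; intros Hn;
    apply (H x); rewrite mem_fusion; tauto.
- intros [H1 H2] x; rewrite mem_fusion; specialize (H1 x); specialize (H2 x).
  tauto.
Qed.

Lemma antiset_spec A : integer_set A -> is_antiset A (antiset A).
Proof. exact (epsilon_spec (inhabits empty) (is_antiset A)). Qed.

Lemma mem_antiset A x : integer_set A -> mem x (antiset A) <-> star_mem x A.
Proof.
intros HA; destruct (proj1 (is_antisetE _ _) (antiset_spec A HA)) as [H1 H2].
split; [apply H2|].
intros [y [Hxy Hy]]; apply (star_mem_antielement _ y x); [|exact (H1 y Hy)].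
exact (antielement_sym _ HV x y Hxy).
Qed.

Lemma star_mem_antiset A x :
  integer_set A -> star_mem x (antiset A) <-> mem x A.
Proof.
intros HA; split.
- intros [y [Hxy Hy]]; apply mem_antiset in Hy; [|exact HA].
  apply (star_mem_antielement _ y x); [|exact Hy].
  exact (antielement_sym _ HV x y Hxy).
- apply (proj1 (is_antisetE _ _) (antiset_spec A HA)).
Qed.

Section IntegerSpace.

Context {A : V} (HA : integer_set A).

Lemma integer_spaceE M :
  integer_space A M <-> forall x, mem x M -> mem x A \/ star_mem x A.
Proof.
split.
- intros (X & Y & HX & HY & ->) x; rewrite mem_fusion, <- (mem_antiset A) by exact HA.
  specialize (HX x); specialize (HY x); tauto.
(* Split [M] into its part inside [A], written as a double difference, and the rest, which lies in
   the antiset of [A]. Their fusion is their union: [M] holds no antielement pair, so nothing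
   cancels. *)
- intros H; exists (diff M (diff M A)), (diff M A); split; [|split].
  + intros x; rewrite !mem_diff; tauto.
  + intros x; rewrite mem_diff, (mem_antiset A) by exact HA.
    specialize (H x); tauto.
  + assert (Hdiff : forall B x, mem x M -> ~ star_mem x (diff M B)).
    { intros B x Hx [y [Hxy Hy]]; apply mem_diff in Hy.
      apply (star_mem_exclusion M x Hx); exists y; tauto. }
    apply (extensionality _ HV); intros x; rewrite mem_fusion, !mem_diff.
    generalize (Hdiff A x), (Hdiff (diff M A) x).
    destruct (classic (mem x A)); tauto.
Qed.

Lemma integer_space_star_mem M x :
  integer_space A M -> star_mem x M -> mem x A \/ star_mem x A.
Proof.
intros HM [y [Hxy Hy]].
destruct (proj1 (integer_spaceE M) HM y Hy) as [H|H].
- right; exists y; auto.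
- left; apply (star_mem_antielement _ y x); [|exact H].
  exact (antielement_sym _ HV x y Hxy).
Qed.

Lemma integer_space_integer_set M : integer_space A M -> integer_set M.
Proof.
(* [B] collects the antielements of elements of [M]. All of them lie in [A] or its antiset, so two
   star-intersections capture them as sigma-sets. *)
intros HM; set (B := fusion (star_cap A M) (star_cap (antiset A) M)).
assert (HB : forall x, mem x B <-> star_mem x M).
{ intros x; unfold B.
  (* No cancellation between the two halves of [B]: otherwise [M] would contain both an element and
     its antielement. *)
  assert (Hcap : forall C, star_mem x M -> ~ star_mem x (star_cap C M)).
  { intros C [y [Hxy Hy]] H; apply (star_mem_antielement _ x y Hxy) in H.
    apply mem_star_cap in H; exact (star_mem_exclusion M y Hy (proj2 H)). }
  rewrite mem_fusion, !mem_star_cap, (mem_antiset A) by exact HA.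
  generalize (integer_space_star_mem M x HM), (Hcap A), (Hcap (antiset A)).
  tauto. }
exists B; apply is_antisetE; split; [|intros x; apply HB].
intros x Hx.
assert (H : exists y, antielement x y).
{ destruct (proj1 (integer_spaceE M) HM x Hx) as [H|[y [H _]]].
  - apply star_mem_antiset in H; [|exact HA].
    destruct H as [y [H _]]; exists y; exact H.
  - exists y; exact H. }
destruct H as [y Hxy]; exists y; split; [exact Hxy|].
apply HB; exists x; split; [exact (antielement_sym _ HV x y Hxy)|exact Hx].
Qed.

Lemma integer_space_fusion M N :
  integer_space A M -> integer_space A N -> integer_space A (fusion M N).
Proof.
rewrite !integer_spaceE; intros HM HN x; rewrite mem_fusion.
specialize (HM x); specialize (HN x); tauto.
Qed.

Lemma integer_space_antiset M : integer_space A M -> integer_space A (antiset M).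
Proof.
intros HM; apply integer_spaceE; intros x.
rewrite mem_antiset by exact (integer_space_integer_set M HM).
exact (integer_space_star_mem M x HM).
Qed.

End IntegerSpace.

Lemma fusionable_star_mem M N x : fusionable M N -> mem x M -> ~ star_mem x N.
Proof.
intros H Hx HN; apply (proj1 (eq_empty _) H x), mem_star_cap; auto.
Qed.

Lemma fusionable_sym M N : fusionable M N -> fusionable N M.
Proof.
intros H; apply eq_empty; intros x Hx.
apply mem_star_cap in Hx; destruct Hx as [Hx [y [Hxy Hy]]].
apply (fusionable_star_mem M N y H Hy); exists x; split; [|exact Hx].
exact (antielement_sym _ HV x y Hxy).
Qed.

(** Passing from [x] to its antielement exchanges [mem] and [star_mem], so this is [mem_fusion] read
    at the antielement. *)
Lemma star_mem_fusion A B x :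
  star_mem x (fusion A B) <->
  (star_mem x A /\ ~ mem x B) \/ (star_mem x B /\ ~ mem x A).
Proof.
split.
- intros [y [Hxy Hy]]; pose proof (antielement_sym _ HV x y Hxy) as Hyx.
  rewrite mem_fusion, !(star_mem_antielement _ y x Hyx) in Hy.
  rewrite !(star_mem_antielement _ x y Hxy); exact Hy.
- intros H.
  assert (Hex : exists y, antielement x y)
    by (destruct H as [[[y [Hy _]] _]|[[y [Hy _]] _]]; exists y; exact Hy).
  destruct Hex as [y Hxy]; pose proof (antielement_sym _ HV x y Hxy) as Hyx.
  rewrite !(star_mem_antielement _ x y Hxy) in *.
  rewrite mem_fusion, !(star_mem_antielement _ y x Hyx); exact H.
Qed.

End SigmaTheory.

Theorem theorem4p11 (V : sigma_structure) (HV : sigma_theory V)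
    (A M N : V) (hA : integer_set A)
    (hM : integer_space A M) (hN : integer_space A N)
    (hMN : fusionable M N) :
  let R := fusion M (antiset N) in
  let S1 := fusion N (antiset R) in
  let S2 := antiset R in
  is_solution A M N S1 /\ is_solution A M N S2.
Proof.
intros R S1 S2.
pose proof (integer_space_integer_set HV hA N hN) as iN.
assert (hR : integer_space A R)
  by (apply (integer_space_fusion HV hA), (integer_space_antiset HV hA); assumption).
pose proof (integer_space_integer_set HV hA R hR) as iR.
pose proof (integer_space_antiset HV hA R hR) as hS2.
(* Each equation is checked elementwise. The first round of rewriting reduces the antiset of [R] to
   statements about [R], the second expands [R]. *)
split; (split; [try apply (integer_space_fusion HV hA); assumption|]);
  apply (extensionality _ HV); intros x; unfold S1, S2;
  rewrite ?(mem_fusion HV), ?(star_mem_fusion HV), ?(mem_antiset HV R),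
    ?(star_mem_antiset HV R) by exact iR;
  unfold R;
  rewrite ?(mem_fusion HV), ?(star_mem_fusion HV), ?(mem_antiset HV N),
    ?(star_mem_antiset HV N) by exact iN;
  (* Four atoms remain: [x] or its antielement in [M] or in [N]. By exclusion and fusionability in
     both directions, if [x] is in [M] or [N] then its antielement is in neither; a truth table
     concludes. *)
  generalize (star_mem_exclusion HV M x), (star_mem_exclusion HV N x),
    (fusionable_star_mem HV M N x hMN),
    (fusionable_star_mem HV N M x (fusionable_sym HV M N hMN));
  destruct (classic (mem x M)), (classic (mem x N)),
    (classic (star_mem x M)), (classic (star_mem x N)); tauto.
Qed.
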